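(* Let $(\bar x,\bar y,\bar\mu)$ be a solution to RMP for which $\bar\mu_p > Q_p(\bar x,\bar y)$ for some $p\in\mathcal P$. Write $d=d_p(\bar y)$. Then $(\bar x,\bar y,\bar\mu)$ violates (i.e. fails to satisfy, when substituted for $(x,y,\mu)$) the optimality cut $$\mu_p \le \sum_{s\in\mathcal S^{\downarrow}_{pd}(\bar x,\bar y)}\pi_{sd}\Big(P_p\sum_{f\in\mathcal F}Y_{pfds}x_{pf}\Big)+\sum_{s\in\mathcal S^{\uparrow}_{pd}(\bar x,\bar y)}\pi_{sd}\Big(O_p\sum_{f\in\mathcal F}Y_{pfds}x_{pf}+(P_p-O_p)D_{pds}\Big)+M_p\Big(|\mathcal F|-\sum_{f\in\mathcal F}y_{p,f,l(p,f,d)}\Big).$$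
   Context: Data. $\mathcal P$ (products) and $\mathcal F$ (facilities) are finite sets. Facility $f$ has capacity $B_f\ge 0$. For $p\in\mathcal P,f\in\mathcal F$, $\mathcal L_{pf}$ is a finite set of production levels; level $l$ has bounds $0\le L_{pfl}\le U_{pfl}$; the intervals $[L_{pfl},U_{pfl}]$, $l\in\mathcal L_{pf}$, are pairwise disjoint and some level has $L_{pfl}=U_{pfl}=0$. $C_{pf}$ is a unit cost, $P_p$ the full price, $O_p$ the discounted price, with $0\le O_p<P_p$ and $O_p<C_{pf}$ for all $f$. For each $p$, $\mathcal D_p$ is a finite set of distributions, and $l(p,f,d)\in\mathcal L_{pf}$ is the level at facility $f$ associated with $d\in\mathcal D_p$; for each $p$, every combination of levels $(l_f)_{f\in\mathcal F}$, $l_f\in\mathcal L_{pf}$, determines exactly one $d\in\mathcal D_p$ with $l(p,f,d)=l_f$ for all $f$. Each $d\in\mathcal D_p$ has a finite scenario set $\mathcal S_{pd}$ with probabilities $\pi_{sd}\ge 0$ summing to $1$; in scenario $s$ the yield at $f$ is $Y_{pfds}\ge 0$ and the demand is $D_{pds}\ge 0$. Variables: $x_{pf}\ge 0$, $y_{pfl}\in\{0,1\}$, $\mu_p$. First-stage constraints: $\sum_{p}x_{pf}\le B_f$ for all $f$; $\sum_{l\in\mathcal L_{pf}}y_{pfl}=1$ and $\sum_l L_{pfl}y_{pfl}\le x_{pf}\le\sum_l U_{pfl}y_{pfl}$ for all $p,f$. For $y$ satisfying these, $d_p(y)$ is the unique $d\in\mathcal D_p$ with $y_{p,f,l(p,f,d)}=1$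 for all $f$. Expected revenue: with $d=d_p(y)$ and $z_{pds}=\sum_{f}Y_{pfds}x_{pf}$, $Q_p(x,y)=\sum_{s\in\mathcal S_{pd}}\pi_{sd}\,\max\{P_pw+O_po: w+o=z_{pds},\ w\le D_{pds},\ w,o\ge0\}$, where the maximum equals $P_p\min\{D_{pds},z_{pds}\}+O_p\max\{z_{pds}-D_{pds},0\}$. Bound: with $\bar Z_{pds}=\sum_f Y_{pfds}\min\{B_f,U_{p,f,l(p,f,d)}\}$, $M_p=\max_{d\in\mathcal D_p}\sum_{s\in\mathcal S_{pd}}\pi_{sd}\big(P_p\min\{D_{pds},\bar Z_{pds}\}+O_p\max\{\bar Z_{pds}-D_{pds},0\}\big)$. RMP (relaxed master problem): maximize $-\sum_{p}\sum_f C_{pf}x_{pf}+\sum_p\mu_p$ subject to the first-stage constraints and $0\le\mu_p\le M_p$ for all $p$ (possibly together with previously added optimality cuts). A solution to RMP is a point $(x,y,\mu)$ satisfying its constraints. Scenario partition: for first-stage feasible $(\bar x,\bar y)$ and $d=d_p(\bar y)$, $\mathcal S^{\uparrow}_{pd}(\bar x,\bar y)=\{s\in\mathcal S_{pd}: D_{pds}<\sum_fY_{pfds}\bar x_{pf}\}$ and $\mathcal S^{\downarrow}_{pd}(\bar x,\bar y)=\mathcal S_{pd}\setminus\mathcal S^{\uparrow}_{pd}(\bar x,\bar y)$. *)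

(* Defs.v *)
From mathcomp Require Import all_boot all_order all_algebra.
From mathcomp Require Import boolp classical_sets reals.

Set Implicit Arguments.
Unset Strict Implicit.
Unset Printing Implicit Defensive.

Import Order.TTheory GRing.Theory Num.Theory.
Local Open Scope ring_scope.

(* The index sets that vary with their parameters (levels per product and
   facility, distributions per product, scenarios per distribution) are
   dependent families of finite types. *)
Record instance (R : realType) := Instance {
  product : finType;
  facility : finType;
  level : product -> facility -> finType;
  dist : product -> finType;
  scenario : forall p, dist p -> finType;

  capacity : facility -> R;
  lower : forall p f, level p f -> R;
  upper : forall p f, level p f -> R;
  unit_cost : product -> facility -> R;
  full_price : product -> R;
  disc_price : product -> R;
  lev : forall p f, dist p -> level p f;
  prob : forall p (d : dist p), scenario d -> R;
  yield : forall p (f : facility) (d : dist p), scenario d -> R;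
  demand : forall p (d : dist p), scenario d -> R;

  capacity_ge0 : forall f, 0 <= capacity f;
  lower_ge0 : forall p f (l : level p f), 0 <= lower l;
  lower_le_upper : forall p f (l : level p f), lower l <= upper l;
  levels_disjoint : forall p f (l l' : level p f) (t : R), l <> l' ->
    ~ (lower l <= t <= upper l /\ lower l' <= t <= upper l');
  level_zero : forall p f,
    exists l : level p f, lower l = 0 /\ upper l = 0;
  disc_price_ge0 : forall p, 0 <= disc_price p;
  disc_lt_full : forall p, disc_price p < full_price p;
  disc_lt_cost : forall p f, disc_price p < unit_cost p f;
  dist_of_levels : forall p (lf : forall f, level p f),
    exists! d : dist p, forall f, lev f d = lf f;
  prob_ge0 : forall p (d : dist p) (s : scenario d), 0 <= prob s;
  prob_sum1 : forall p (d : dist p), \sum_(s : scenario d) prob s = 1;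
  yield_ge0 : forall p f (d : dist p) (s : scenario d), 0 <= yield f s;
  demand_ge0 : forall p (d : dist p) (s : scenario d), 0 <= demand s
}.

Section Model.
Variables (R : realType) (I : instance R).

Definition xvar := product I -> facility I -> R.
Definition yvar := forall (p : product I) (f : facility I), level p f -> bool.
Definition muvar := product I -> R.

Implicit Types (p : product I) (x : xvar) (y : yvar) (mu : muvar).

Record first_stage x y : Prop := FirstStage {
  x_ge0 : forall p f, 0 <= x p f;
  x_capacity : forall f, \sum_p x p f <= capacity f;
  y_sum1 : forall p f, \sum_(l : level p f) (y p f l)%:R = 1 :> R;
  x_lower : forall p f,
    \sum_(l : level p f) lower l * (y p f l)%:R <= x p f;
  x_upper : forall p f,
    x p f <= \sum_(l : level p f) upper l * (y p f l)%:R
}.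

Lemma dist_inhabited p : exists d : dist p, d \in dist p.
Proof.
have [d _] := dist_of_levels (fun f => sval (cid (level_zero p f))).
by exists d.
Qed.

Definition dist0 p : dist p := xchoose (dist_inhabited p).

Definition compatible y p (d : dist p) : bool :=
  [forall f : facility I, y p f (lev f d)].

(* The default [dist0 p] is irrelevant when the first-stage constraints hold:
   see [dist_ofP]. *)
Definition dist_of y p : dist p :=
  odflt (dist0 p) [pick d : dist p | compatible y d].

Lemma dist_ofP x y p : first_stage x y ->
  compatible y (dist_of y p) /\
  forall d : dist p, compatible y d -> d = dist_of y p.
Proof.
move=> fs.
have ysel f : exists l : level p f, y p f l.
  case: (boolP [exists l, y p f l]) => [/fintype.existsP //|/fintype.existsPn yN].
  have := y_sum1 fs p f; rewrite big1 => [|l _]; last by rewrite (negbTE (yN l)).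
  by move/esym/eqP; rewrite oner_eq0.
have yuniq f (l l' : level p f) : y p f l -> y p f l' -> l = l'.
  move=> yl yl'; case: (eqVneq l l') => // ll'.
  have := y_sum1 fs p f; rewrite -natr_sum => /eqP.
  rewrite (bigD1 l) //= (bigD1 l') 1?eq_sym //= yl yl' addnA.
  by rewrite -[1]/(1%:R) eqr_nat.
have [d [dl _]] := dist_of_levels (fun f => sval (cid (ysel f))).
have cd : compatible y d by apply/forallP => f; rewrite dl; case: cid.
have cuniq (d1 d2 : dist p) : compatible y d1 -> compatible y d2 -> d1 = d2.
  move=> /forallP c1 /forallP c2.
  have [d3 [_ u]] := dist_of_levels (fun f => lev f d2).
  rewrite -(u d1) ?(u d2) // => f; exact: yuniq.
rewrite /dist_of; case: pickP => [d' cd'|/(_ d)]; last by rewrite cd.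
by split=> // d1 cd1; apply: cuniq.
Qed.

Definition output x p (d : dist p) (s : scenario d) : R :=
  \sum_(f : facility I) yield f s * x p f.

Definition recourse_values p (d : dist p) (s : scenario d) (z : R) : set R :=
  [set v | exists w o : R, [/\ w + o = z, w <= demand s, 0 <= w, 0 <= o &
    v = full_price p * w + disc_price p * o]]%classic.

(* For a nonnegative [z] the supremum is attained, hence a maximum. *)
Definition recourse p (d : dist p) (s : scenario d) (z : R) : R :=
  sup (recourse_values s z).

Definition Q p x y : R :=
  let d := dist_of y p in
  \sum_(s : scenario d) prob s * recourse s (output x s).

Definition Zbar p (d : dist p) (s : scenario d) : R :=
  \sum_(f : facility I) yield f s * Num.min (capacity f) (upper (lev f d)).

Definition Mval p (d : dist p) : R :=
  \sum_(s : scenario d) prob s *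
    (full_price p * Num.min (demand s) (Zbar s) +
     disc_price p * Num.max (Zbar s - demand s) 0).

(* [dist p] is nonempty; taking the value at [dist0 p] as neutral element
   makes this the maximum of [Mval] over [dist p] without any sign argument. *)
Definition M p : R := \big[Num.max/Mval (dist0 p)]_(d : dist p) Mval d.

Definition S_up x p (d : dist p) : {set scenario d} :=
  [set s : scenario d | demand s < output x s].

Definition S_down x p (d : dist p) : {set scenario d} := ~: S_up x d.

(* The cut for product [p] generated at [(xb, yb)], evaluated at
   [(x, y, mu)]. *)
Definition satisfies_cut p (xb : xvar) (yb : yvar) x y mu : Prop :=
  let d := dist_of yb p in
  mu p <=
    \sum_(s in S_down xb d) prob s *
      (full_price p * \sum_(f : facility I) yield f s * x p f) +
    \sum_(s in S_up xb d) prob s *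
      (disc_price p * (\sum_(f : facility I) yield f s * x p f) +
       (full_price p - disc_price p) * demand s) +
    M p * (#|facility I|%:R - \sum_(f : facility I) (y p f (lev f d))%:R).

Record cut := Cut {
  cut_product : product I;
  cut_x : xvar;
  cut_y : yvar;
  cut_first_stage : first_stage cut_x cut_y
}.

(* Constraints of the relaxed master problem with [n] previously added cuts. *)
Definition RMP_solution n (cuts : 'I_n -> cut) x y mu : Prop :=
  [/\ first_stage x y,
      forall p, 0 <= mu p <= M p &
      forall i, satisfies_cut (cut_product (cuts i))
                  (cut_x (cuts i)) (cut_y (cuts i)) x y mu].

End Model.

Arguments xvar {R} I.
Arguments yvar {R} I.
Arguments muvar {R} I.
Arguments cut {R} I.

(* Main.v *)
Require Import Defs.
From mathcomp Require Import all_boot all_order all_algebra reals.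
From mathcomp Require Import classical_sets lra.
Import Order.TTheory GRing.Theory Num.Theory.
Local Open Scope ring_scope.

(** The cut generated at a first-stage feasible point [(xb, yb)] is tight there:
    its right-hand side at that point is exactly [Q p xb yb].  The big-M term
    vanishes, since [yb] selects every level of its own distribution
    ([sum_selected_levels]).  The remaining sums evaluate the recourse scenario
    by scenario: as the discounted price is below the full price, it is optimal
    to sell at full price up to the demand ([recourse_no_surplus],
    [recourse_surplus]), and the scenario partition records whether the demand
    is exceeded.  Hence [mub p > Q p xb yb] says that the cut fails. *)

Section Tightness.
Variables (R : realType) (I : instance R).

Lemma sup_of_max (A : set R) (v : R) : A v -> ubound A v -> sup A = v.
Proof.
move=> Av Aub; apply/le_anti/andP; split.
  by apply: ge_sup => //; exists v.
by apply: ub_le_sup => //; exists v.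
Qed.

Lemma recourse_no_surplus (p : product I) (d : dist p) (s : scenario d) (z : R) :
  0 <= z -> z <= demand s -> recourse s z = full_price p * z.
Proof.
move=> z0 zD; apply: sup_of_max.
  by exists z, 0; split=> //; rewrite ?addr0 // mulr0 addr0.
move=> _ [w [o [<- _ _ o0 ->]]].
by have := disc_lt_full p; nra.
Qed.

Lemma recourse_surplus (p : product I) (d : dist p) (s : scenario d) (z : R) :
  demand s <= z ->
  recourse s z = disc_price p * z + (full_price p - disc_price p) * demand s.
Proof.
move=> Dz; apply: sup_of_max.
  exists (demand s), (z - demand s); split; rewrite ?subr_ge0 //.
  - by rewrite addrC subrK.
  - exact: demand_ge0.
  - by lra.
move=> _ [w [o [<- wD _ _ ->]]].
by have := disc_lt_full p; nra.
Qed.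

Lemma output_ge0 (x : xvar I) (y : yvar I) (p : product I) (d : dist p)
    (s : scenario d) :
  first_stage x y -> 0 <= output x s.
Proof.
move=> fs; apply: sumr_ge0 => f _.
by rewrite mulr_ge0 ?yield_ge0 ?(x_ge0 fs).
Qed.

Lemma sum_selected_levels (y : yvar I) (p : product I) (d : dist p) :
  compatible y d ->
  \sum_(f : facility I) (y p f (lev f d))%:R = #|facility I|%:R :> R.
Proof.
move=> /forallP yd; rewrite (eq_bigr (fun=> 1)) => [|f _]; last by rewrite yd.
by rewrite sumr_const.
Qed.

Lemma Q_scenario_partition (x : xvar I) (y : yvar I) (p : product I) :
  first_stage x y ->
  let d := dist_of y p in
  Q p x y =
    \sum_(s in S_down x d) prob s * (full_price p * output x s) +
    \sum_(s in S_up x d) prob s *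
      (disc_price p * output x s +
       (full_price p - disc_price p) * demand s).
Proof.
move=> fs d; rewrite /Q -/d (bigID (mem (S_down x d))) /=.
congr (_ + _).
  apply: eq_bigr => s; rewrite !inE -leNgt => zD.
  by rewrite recourse_no_surplus // (output_ge0 _ _ _ _ _ fs).
apply: eq_big => [s|s]; rewrite !inE negbK // => /ltW Dz.
by rewrite recourse_surplus.
Qed.

Lemma satisfies_own_cutE (x : xvar I) (y : yvar I) (mu : muvar I)
    (p : product I) :
  first_stage x y -> satisfies_cut p x y x y mu = (mu p <= Q p x y).
Proof.
move=> fs; rewrite /satisfies_cut sum_selected_levels.
  by rewrite subrr mulr0 addr0 Q_scenario_partition.
by case: (dist_ofP p fs).
Qed.

End Tightness.

Theorem proposition1 (R : realType) (I : instance R)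
  (n : nat) (cuts : 'I_n -> cut I)
  (xb : xvar I) (yb : yvar I) (mub : muvar I) (p : product I) :
  RMP_solution cuts xb yb mub ->
  Q p xb yb < mub p ->
  ~ satisfies_cut p xb yb xb yb mub.
Proof.
move=> [fs _ _] Qmu.
by rewrite satisfies_own_cutE // leNgt Qmu.
Qed.
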